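(* Let $(Y(t):t\ge0)$ be a continuous-time Markov chain with a finite state space $\mathcal Y$ and generator $\mathcal G_Y$. Let $\Phi:\bar{\mathcal Y}\to[0,\infty)$ be a function defined on a set $\bar{\mathcal Y}\supseteq\mathcal Y$ such that there exists $\mathcal Y_0\subseteq\mathcal Y$ with $\Phi(y)=0$ for all $y\in\mathcal Y_0$, $\Phi_{\min}:=\min_{y\in\mathcal Y\setminus\mathcal Y_0}\Phi(y)>0$, and $$\mathcal G_Y\Phi(y)\le-c\,\Phi(y)\quad\text{for all }y\in\mathcal Y,$$ for some constant $c>0$. Then the hitting time $\tau=\inf\{t\ge0:Y(t)\in\mathcal Y_0\}$ satisfies $$\mathbb{E}_y[\tau]\le\frac{1+\log\left(\Phi(y)/\Phi_{\min}\right)}{c}\quad\text{for all }y\in\mathcal Y\setminus\mathcal Y_0 .$$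
   Context: The generator acts by $\mathcal G_Y\Phi(y)=\sum_{y'\ne y}q_{y,y'}(\Phi(y')-\Phi(y))$, where $q_{y,y'}$ is the transition rate from $y$ to $y'$. $\mathbb{E}_y$ denotes expectation conditioned on $Y(0)=y$. *)

(* Defs.v *)
From HB Require Import structures.
From mathcomp Require Import all_boot all_order all_algebra finmap.
From mathcomp Require Import all_classical all_reals all_analysis.
Import Order.TTheory GRing.Theory Num.Theory.
Import numFieldNormedType.Exports.

Set Implicit Arguments.
Unset Strict Implicit.
Unset Printing Implicit Defensive.

Local Open Scope classical_set_scope.
Local Open Scope ring_scope.

(* Only the off-diagonal entries of [q] are used; the diagonal is irrelevant. *)
Definition generator (R : realType) (S : finType) (q : S -> S -> R)
    (f : S -> R) (y : S) : R :=
  \sum_(y' | y' != y) q y y' * (f y' - f y).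

Record is_transition_function (R : realType) (S : finType)
    (p : R -> S -> S -> R) : Prop := IsTransitionFunction {
  transition_ge0 : forall t x y, 0 <= t -> 0 <= p t x y;
  transition_sum1 : forall t x, 0 <= t -> \sum_y p t x y = 1;
  transition_0 : forall x y, p 0 x y = (x == y)%:R;
  chapman_kolmogorov : forall s t x y, 0 <= s -> 0 <= t ->
    p (s + t) x y = \sum_z p s x z * p t z y }.

Definition has_rates (R : realType) (S : finType) (p : R -> S -> S -> R)
    (q : S -> S -> R) : Prop :=
  forall x y, x != y -> p h x y / h @[h --> 0^'+] --> q x y.

(* P(X_{s_0} = x_0, ..., X_{s_n} = x_n, X_{s_n + h} = y)
     = P(X_{s_0} = x_0, ..., X_{s_n} = x_n) * p_h(x_n, y)
   for 0 <= s_0 <= ... <= s_n; the product form covers null events, and only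
   the first n + 1 terms of the sequences [s] and [x] matter. *)
Definition markov_property d (Omega : measurableType d) (R : realType)
    (S : finType) (P : probability Omega R) (X : R -> Omega -> S)
    (p : R -> S -> S -> R) : Prop :=
  forall (n : nat) (s : nat -> R) (x : nat -> S) (h : R) (y : S),
    0 <= s 0%N -> (forall i, (i < n)%N -> s i <= s i.+1) -> 0 <= h ->
    let past := [set w | forall i, (i <= n)%N -> X (s i) w = x i] in
    P (past `&` [set w | X (s n + h) w = y]) = (P past * (p h (x n) y)%:E)%E.

(* Time is the half-line 0 <= t; the values X t for t < 0 are irrelevant.
   The initial law is arbitrary.  Paths are right-continuous for the discrete
   topology on S. *)
Record is_ctmc d (Omega : measurableType d) (R : realType) (S : finType)
    (P : probability Omega R) (X : R -> Omega -> S) (q : S -> S -> R) : Prop :=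
  IsCTMC {
  ctmc_measurable : forall t y, 0 <= t -> measurable [set w | X t w = y];
  ctmc_right_continuous : forall w t, 0 <= t ->
    \forall u \near t^'+, X u w = X t w;
  ctmc_markov : exists p : R -> S -> S -> R,
    [/\ is_transition_function p, has_rates p q & markov_property P X p] }.

(* Equal to +oo when A is never reached. *)
Definition hitting_time (Omega : Type) (R : realType) (S : finType)
    (X : R -> Omega -> S) (A : set S) (w : Omega) : \bar R :=
  ereal_inf [set t%:E | t in [set t : R | 0 <= t /\ A (X t w)]].

(* E[f | A], meaningful when P A > 0. *)
Definition cond_expectation d (Omega : measurableType d) (R : realType)
    (P : probability Omega R) (f : Omega -> \bar R) (A : set Omega) : \bar R :=
  ((\int[P]_(w in A) f w) * ((fine (P A))^-1)%:E)%E.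

Definition is_minimum (R : realType) (A : set R) (m : R) : Prop :=
  A m /\ lbound A m.

(* Main.v *)
(* Since [f = Phi] is at least [m = Phi_min] outside the target [A], Markov's
   inequality and [E_y f(X_t) <= exp(-c t) f(y)] give
     P_y(X_t notin A) <= min(1, C exp(-c t)),  C = f(y) / m >= 1.
   On the time grid [h k] the hitting time is at most [h] times the number of
   grid points at which the chain is outside [A]; this dominating series is
   measurable, and its expectation is at most
     sum_k h min(1, C exp(-c h k)) <= (1 + ln C) / c + 2 h.
   Let [h] tend to 0. *)
Require Import Defs.
From HB Require Import structures.
From mathcomp Require Import all_boot all_order all_algebra finmap.
From mathcomp Require Import all_classical all_reals all_analysis.
From mathcomp Require Import measurable_realfun ring lra.
Import Order.TTheory GRing.Theory Num.Theory.
Import numFieldNormedType.Exports.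

Local Open Scope classical_set_scope.
Local Open Scope ring_scope.

(* For nonnegative functions the integral is a supremum over the simple
   functions below, which is monotone whether or not [f] and [g] are
   measurable. *)
Lemma ge0_le_integral_nonmeasurable (d : measure_display)
    (T : measurableType d) (R : realType) (mu : {measure set T -> \bar R})
    (D : set T) (f g : T -> \bar R) :
  (forall x, D x -> 0 <= f x)%E -> (forall x, D x -> f x <= g x)%E ->
  (\int[mu]_(x in D) f x <= \int[mu]_(x in D) g x)%E.
Proof.
move=> f0 fg.
have g0 x : D x -> (0 <= g x)%E by move=> Dx; rewrite (le_trans (f0 x Dx)) ?fg.
rewrite !ge0_integralE//; apply: le_ereal_sup => _ [h hf <-]; exists h => // x.
by rewrite (le_trans (hf x)) ?lee_restrict.
Qed.

(** * Exponential decay of the mean of [f] along the transition semigroup *)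

Section semigroup.
Context {R : realType} {S : finType} {p : R -> S -> S -> R}.
Hypothesis p_trans : is_transition_function p.

(** Row sums equal to 1 turn the quotient into a finite sum of [p h x y / h * (f y - f x)]; its
    diagonal term vanishes, and [has_rates] gives the limit of each other term. *)
Lemma generator_cvg (q : S -> S -> R) (f : S -> R) (x : S) :
  has_rates p q ->
  (\sum_y p h x y * f y - f x) / h @[h --> 0^'+] --> generator q f x.
Proof.
move=> pq.
have : \sum_(y | y != x) p h x y / h * (f y - f x) @[h --> 0^'+]
    --> generator q f x.
  apply: cvg_big => [|y yx].
    exact: add_continuous.
  by apply: cvgM; [apply: pq; rewrite eq_sym|exact: cvg_cst].
apply: cvg_trans; apply: near_eq_cvg; near=> h.
have h0 : 0 <= h by near: h; exact: nbhs_right_ge.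
rewrite -[f x in RHS]mul1r -(transition_sum1 p_trans x h0) mulr_suml -sumrB.
rewrite [in RHS](bigD1 x)//= subrr add0r mulr_suml.
by apply: eq_bigr => y _; rewrite -mulrBr mulrAC.
Unshelve. all: by end_near. Qed.

(* Euler scheme: for small [h] one step multiplies by at most [1 - c h] up to an
   error [e c h], and [e] is the fixed point of [u |-> (1 - c h) u + e c h]. *)
Lemma transition_drift_le {q : S -> S -> R} {f : S -> R} {c : R} :
  has_rates p q -> (forall y, 0 <= f y) -> 0 < c ->
  (forall y, generator q f y <= - c * f y) ->
  forall t x, 0 <= t -> \sum_y p t x y * f y <= expR (- c * t) * f x.
Proof.
move=> pq f0 c0 drift t x t0; apply/ler_addgt0Pr => e e0.
have ec0 : 0 < e * c by rewrite mulr_gt0.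
have [r /= r0 step] : \forall h \near 0^'+,
    forall z, \sum_y p h z y * f y <= (1 - c * h) * f z + e * c * h.
  (* Finiteness of [S] yields one radius [r] for all states; the slack [e * c] makes the bound on
     the limit strict. *)
  apply: filter_forall => z; near=> h.
  have h0 : 0 < h by near: h; exact: nbhs_right_gt.
  have : (\sum_y p h z y * f y - f z) / h < - c * f z + e * c.
    near: h; apply: (cvgr_lt (generator q f z)); first exact: generator_cvg.
    by rewrite (le_lt_trans (drift z))// ltrDl.
  rewrite ltr_pdivrMr// ltrBlDr => /ltW /le_trans; apply.
  lra.
have [n [n1 tr ct]] : exists n : nat,
    [/\ 0 < n%:R :> R, t / n%:R < r & c * (t / n%:R) <= 1].
  (* The summand [t / r] forces [t / n < r]; the summand [c * t] forces [c * (t / n) <= 1], which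
     keeps the Euler factor [1 - c * h] nonnegative. *)
  exists (Num.truncn (t / r + c * t)).+1; split; first by rewrite ltr0n.
    rewrite ltr_pdivrMr ?ltr0n// -ltr_pdivrMl// mulrC.
    by rewrite (le_lt_trans _ (truncnS_gt _))// lerDl mulr_ge0// ltW.
  rewrite mulrA ler_pdivrMr ?ltr0n// mul1r ltW//.
  by rewrite (le_lt_trans _ (truncnS_gt _))// lerDr divr_ge0// ltW.
set h := t / n%:R in tr ct.
have h_ge0 : 0 <= h by rewrite divr_ge0// ltW.
have -> : t = h * n%:R by rewrite divfK// gt_eqF.
have p0 : \sum_y p 0 x y * f y = f x.
  rewrite (bigD1 x)//= big1 => [|y yx].
    by rewrite (transition_0 p_trans) eqxx mul1r addr0.
  by rewrite (transition_0 p_trans) eq_sym (negbTE yx) mul0r.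
have [h0|h0] := eqVneq h 0.
  by rewrite h0 mul0r mulr0 expR0 mul1r p0 lerDl ltW.
have h_gt0 : 0 < h by rewrite lt_neqAle eq_sym h0.
have stepz z : \sum_y p h z y * f y <= (1 - c * h) * f z + e * c * h.
  by apply: step => //=; rewrite sub0r normrN gtr0_norm.
have euler k : \sum_y p (h * k%:R) x y * f y <= (1 - c * h) ^+ k * f x + e.
  elim: k => [|k IH]; first by rewrite mulr0 expr0 mul1r p0 lerDl ltW.
  have hk0 : 0 <= h * k%:R by rewrite mulr_ge0.
  have -> : \sum_y p (h * k.+1%:R) x y * f y =
      \sum_z p (h * k%:R) x z * (\sum_y p h z y * f y).
    under eq_bigr => y _.
      rewrite -addn1 natrD mulrDr mulr1 (chapman_kolmogorov p_trans)//.
      rewrite mulr_suml; over.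
    rewrite exchange_big /=; apply: eq_bigr => z _; rewrite mulr_sumr.
    by apply: eq_bigr => y _; rewrite mulrA.
  apply: (@le_trans _ _ (\sum_z p (h * k%:R) x z *
      ((1 - c * h) * f z + e * c * h))).
    by apply: ler_sum => z _; rewrite ler_wpM2l// (transition_ge0 p_trans).
  under eq_bigr do rewrite mulrDr mulrCA.
  rewrite big_split /= -mulr_sumr -mulr_suml (transition_sum1 p_trans)// mul1r.
  apply: (@le_trans _ _
      ((1 - c * h) * ((1 - c * h) ^+ k * f x + e) + e * c * h)).
    by rewrite lerD2r ler_wpM2l// subr_ge0.
  by rewrite exprS; lra.
(* It remains to raise [1 - c * h <= expR (- c * h)] to the power [n]. *)
rewrite (le_trans (euler n))// lerD2r ler_wpM2r// [- c * _]mulrA expRM_natr.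
by rewrite lerXn2r// ?nnegrE ?expR_ge0 ?subr_ge0// mulNr expR_ge1Dx.
Unshelve. all: by end_near. Qed.

End semigroup.

(* [C * r ^+ k] is at most 1 from the first index [K > ln C / (c h)] on,
   so the sum is at most [h K] plus a geometric series, and
   [h / (1 - r) <= 1 / c + h]. *)
Lemma riemann_sum_min1_expR {R : realType} {c h C : R} (n : nat) :
  0 < c -> 0 < h -> 1 <= C ->
  \sum_(0 <= k < n) h * Num.min 1 (C * expR (- c * (h * k%:R)))
    <= (1 + ln C) / c + h * 2.
Proof.
move=> c0 h0 C1.
have C0 : 0 < C by rewrite (lt_le_trans ltr01).
have ch0 : 0 < c * h by rewrite mulr_gt0.
pose r := expR (- (c * h)).
have r0 : 0 < r by exact: expR_gt0.
have r1 : r < 1 by rewrite expR_lt1 oppr_lt0.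
pose K := (Num.truncn (ln C / (c * h))).+1.
have Kle : h * K%:R <= ln C / c + h.
  have /truncn_itv/andP[+ _] : 0 <= ln C / (c * h).
    by rewrite divr_ge0 ?ln_ge0// ltW.
  rewrite ler_pdivlMr// => tle.
  rewrite /K -addn1 natrD mulrDr mulr1 lerD2r ler_pdivlMr//.
  by rewrite mulrAC mulrC (mulrC h).
have CrK : C * r ^+ K <= 1.
  rewrite -[X in X * _]lnK ?posrE// -expRM_natr -expRD -[leRHS]expR0 ler_expR.
  rewrite mulNr subr_le0 mulrC -ler_pdivrMr//.
  exact: ltW (truncnS_gt _).
have tail : h / (1 - r) <= c^-1 + h.
  have r1' : 0 < 1 - r by rewrite subr_gt0.
  (* This is [1 + c * h <= expR (c * h)] multiplied by [r]; solving for [1 - r] gives the bound. *)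
  have : (1 + c * h) * r <= 1.
    rewrite -[leRHS](expRxMexpNx_1 (c * h)) ler_wpM2r ?(ltW r0)//.
    exact: expR_ge1Dx.
  rewrite ler_pdivrMr// => H.
  have -> : c^-1 + h = (1 + c * h) / c by field; rewrite gt_eqF.
  by rewrite mulrAC ler_pdivlMr//; clear -H; lra.
(* Adding [K] nonnegative terms allows a cut at [K] whatever [n] is: [K] terms at most [h], then [n]
   geometric ones. *)
apply: (@le_trans _ _ (\sum_(0 <= k < n + K) h * Num.min 1 (C * r ^+ k))).
  rewrite (big_cat_nat (n := n) _ (leq_addr _ _))//=.
  under eq_bigr do rewrite mulrA mulNr expRM_natr.
  rewrite lerDl sumr_ge0// => k _.
  by rewrite mulr_ge0 ?le_min ?ler01 ?mulr_ge0 ?exprn_ge0 ?ltW.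
rewrite addnC (big_cat_nat (n := K) _ (leq_addr _ _))//=.
apply: (@le_trans _ _ (h * K%:R + h / (1 - r))); last first.
  by rewrite mulrDl mul1r; clear -Kle tail; lra.
apply: lerD.
  rewrite mulr_natr -[X in _ <= _ *+ X]subn0 -sumr_const_nat.
  by apply: ler_sum => k _; rewrite ler_piMr ?ge_min ?lexx// ltW.
rewrite -mulr_sumr ler_wpM2l ?(ltW h0)//.
rewrite -[leRHS]mul1r; apply: le_trans (geometric_le_lim n ler01 r0 _).
  2: by rewrite gtr0_norm.
rewrite -{1}[K]add0n big_addn addKn /series/=; apply: ler_sum => k _.
rewrite ge_min; apply/orP; right.
by rewrite addnC exprD mulrA ler_wpM2r// exprn_ge0// ltW.
Qed.

(** * From tail probabilities to the expected hitting time *)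

Section ctmc.
Context {d : measure_display} {Omega : measurableType d} {R : realType}
  {S : finType} {P : probability Omega R} {X : R -> Omega -> S}
  {q : S -> S -> R}.
Hypothesis X_ctmc : is_ctmc P X q.

Lemma measurable_ctmc_in (A : set S) (t : R) :
  0 <= t -> measurable [set w | A (X t w)].
Proof.
move=> t0.
have -> : [set w | A (X t w)] =
    \bigcup_(z in A) [set w | X t w = z].
  apply/seteqP; split=> [w Aw|w [z Az Xz]]; first by exists (X t w).
  by rewrite /= Xz.
apply: fin_bigcup_measurable => [|z _]; first exact: finite_finset.
exact: (ctmc_measurable X_ctmc).
Qed.

(** The product form replaces conditioning, so initial states of probability zero are covered
    too. *)
Lemma ctmc_tail_le {f : S -> R} {c m : R} {A : set S} :
  (forall y, 0 <= f y) -> 0 < c -> 0 < m -> (forall y, ~ A y -> m <= f y) ->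
  (forall y, generator q f y <= - c * f y) ->
  forall y t, 0 <= t ->
  (P ([set w | X 0 w = y] `&` [set w | ~ A (X t w)])
   <= P [set w | X 0 w = y] * (Num.min 1 (f y / m * expR (- c * t)))%:E)%E.
Proof.
move=> f0 c0 m0 fm drift y t t0.
case: (ctmc_markov X_ctmc) => p [p_trans pq XM].
set B := [set w | X 0 w = y].
have mB : measurable B by exact: (ctmc_measurable X_ctmc).
have law z : (P (B `&` [set w | X t w = z]) = P B * (p t y z)%:E)%E.
  (* With [n = 0] the past is the single event [X 0 w = y]. *)
  have := XM 0%N (fun=> 0) (fun=> y) t z (lexx _) (fun _ _ => lexx _) t0.
  suff -> : [set w | forall i, (i <= 0)%N -> X 0 w = y] = B by rewrite add0r.
  by apply/seteqP; split=> [w /(_ 0%N)|w Bw i _] //; exact.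
have mBX z : measurable (B `&` [set w | X t w = z]).
  by apply: measurableI => //; exact: (ctmc_measurable X_ctmc).
rewrite /Num.min; case: ifPn => _.
  rewrite mule1; apply: le_measure; rewrite ?inE//.
  by apply: measurableI => //; exact: (measurable_ctmc_in (~` A)).
have -> : B `&` [set w | ~ A (X t w)] =
    \big[setU/set0]_(z | z \in ~` A) (B `&` [set w | X t w = z]).
  rewrite -bigcup_pred; apply/seteqP; split=> [w [Bw Aw]|w [z /= zA [Bw Xz]]].
    by exists (X t w) => //=; rewrite inE.
  by split=> //; rewrite inE in zA; rewrite Xz.
(* Measurability is carried through the induction because subadditivity of [P] asks for it at each
   union. *)
have [_ /le_trans] : measurable (\big[setU/set0]_(z | z \in ~` A)
      (B `&` [set w | X t w = z])) /\
    (P (\big[setU/set0]_(z | z \in ~` A) (B `&` [set w | X t w = z]))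
     <= \sum_(z | z \in ~` A) P B * (p t y z)%:E)%E.
  apply: (big_ind2 (fun E r => measurable E /\ (P E <= r)%E)).
  - by rewrite measure0.
  - move=> E r E' r' [mE Er] [mE' Er']; split; first exact: measurableU.
    by rewrite (le_trans (measureU2 _ _ _))// leeD.
  - by move=> z _; split=> //; rewrite law.
apply.
rewrite -ge0_sume_distrr => [|z _]; last first.
  by rewrite lee_fin (transition_ge0 p_trans).
rewrite lee_wpmul2l// sumEFin lee_fin mulrAC ler_pdivlMr// mulrC [leRHS]mulrC.
apply: le_trans (transition_drift_le p_trans pq f0 c0 drift t y t0).
(* Markov's inequality: drop the nonnegative terms in [A], and use [m <= f] on the others. *)
rewrite [leRHS](bigID (mem (~` A)))/= mulr_sumr.
rewrite ler_wpDr ?sumr_ge0// => [z _|].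
  by rewrite mulr_ge0// (transition_ge0 p_trans).
apply: ler_sum => z; rewrite inE => Az.
by rewrite mulrC ler_wpM2l ?fm// (transition_ge0 p_trans).
Qed.

(** If the first grid point in [A] has index [n], the [n] earlier ones contribute [h * n], a time at
    which the chain is in [A]. If there is none, the series diverges. *)
Lemma hitting_time_le_grid (A : set S) (h : R) (w : Omega) : 0 < h ->
  (hitting_time X A w
   <= \sum_(0 <= k <oo) h%:E * (\1_[set w | ~ A (X (h * k%:R) w)] w)%:E)%E.
Proof.
move=> h0.
set u := fun k : nat =>
  (h%:E * (\1_[set w | ~ A (X (h * k%:R) w)] w)%:E)%E.
have u0 k : (0 <= u k)%E by rewrite mule_ge0// lee_fin// ltW.
have sumn n : (forall k, (k < n)%N -> ~ A (X (h * k%:R) w)) ->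
    ((h * n%:R)%:E <= \sum_(0 <= k <oo) u k)%E.
  move=> nA; apply: le_trans (nneseries_lim_ge n _); last by [].
  rewrite [leRHS](@eq_big_nat _ _ _ _ _ _ (fun=> h%:E)) => [|k /andP[_ kn]].
    by rewrite sumEFin sumr_const_nat subn0 mulr_natr.
  by rewrite /u indicE mem_set ?mule1//; exact: nA.
have [[k Ak]|nA] := pselect (exists k : nat, A (X (h * k%:R) w)).
  have exA : exists k : nat, `[< A (X (h * k%:R) w) >].
    by exists k; apply/asboolP.
  case: (ex_minnP exA) => n /asboolP An minn.
  apply: le_trans (sumn n _) => [|j jn Aj].
    apply: ereal_inf_lbound; exists (h * n%:R) => //; split=> //.
    by rewrite mulr_ge0// ltW.
  by have := minn j (asboolT Aj); rewrite leqNgt jn.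
rewrite (_ : \sum_(0 <= k <oo) u k = +oo)%E ?leey//; apply/eqyP => r r0.
apply: le_trans (sumn (Num.truncn (r / h)).+1 _) => [|k _ Ak].
  2: by apply: nA; exists k.
by rewrite lee_fin -ler_pdivrMl// mulrC ltW// truncnS_gt.
Qed.

Lemma expected_hitting_time_le {f : S -> R} {c m : R} {A : set S} :
  (forall y, 0 <= f y) -> 0 < c -> 0 < m -> (forall y, ~ A y -> m <= f y) ->
  (forall y, generator q f y <= - c * f y) ->
  forall y, ~ A y -> (0 < P [set w | X 0 w = y])%E ->
  (cond_expectation P (hitting_time X A) [set w | X 0 w = y]
   <= ((1 + ln (f y / m)) / c)%:E)%E.
Proof.
move=> f0 c0 m0 fm drift y yA PB0; rewrite /cond_expectation.
set B := [set w | X 0 w = y] in PB0 *.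
have mB : measurable B by exact: (ctmc_measurable X_ctmc).
have PBfin : P B \is a fin_num by exact: fin_num_measure.
(* Clearing the division by [P B] leaves an integral over [B] to bound, up to a slack [e]. *)
rewrite lee_pdivrMr ?fine_gt0 ?PB0 ?ltey_eq ?PBfin// fineK//.
apply/lee_addgt0Pr => e e0.
have [h h0 he] : exists2 h : R, 0 < h & h * 2 = e.
  by exists (e / 2); rewrite ?divr_gt0 ?divfK.
pose N k := [set w | ~ A (X (h * k%:R) w)].
have mN k : measurable (N k).
  by apply: (measurable_ctmc_in (~` A)); rewrite mulr_ge0// ltW.
have mu k : measurable_fun B (fun w => h%:E * (\1_(N k) w)%:E)%E.
  by apply: measurable_funeM; apply/measurable_EFinP; exact: measurable_indic.
have u0 k w : B w -> (0 <= h%:E * (\1_(N k) w)%:E)%E.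
  by move=> _; rewrite mule_ge0// lee_fin// ltW.
apply: (@le_trans _ _
    (\int[P]_(w in B) \sum_(0 <= k <oo) h%:E * (\1_(N k) w)%:E)%E).
  apply: ge0_le_integral_nonmeasurable => w _; last exact: hitting_time_le_grid.
  by apply: le_ereal_inf_tmp => _ [t [t0 _] <-]; rewrite lee_fin.
rewrite integral_nneseries//.
(* The bound is proved for every partial sum, uniformly in [n]. *)
apply: lime_le.
  by apply: is_cvg_nneseries => k _ _; apply: integral_ge0; exact: u0.
apply: nearW => n.
have intN k :
    (\int[P]_(w in B) (h%:E * (\1_(N k) w)%:E) = h%:E * P (B `&` N k))%E.
  rewrite ge0_integralZl_EFin ?ltW// ?integral_indic// 1?setIC//.
  by apply/measurable_EFinP; exact: measurable_indic.
under eq_bigr do rewrite intN.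
have C1 : 1 <= f y / m by rewrite ler_pdivlMr// mul1r fm.
apply: (@le_trans _ _ (P B * ((1 + ln (f y / m)) / c + h * 2)%:E)%E).
  have := riemann_sum_min1_expR n c0 h0 C1; rewrite -lee_fin.
  move=> /(lee_wpmul2l (measure_ge0 P B)); apply: le_trans.
  rewrite -sumEFin ge0_sume_distrr => [|k _]; last first.
    by rewrite lee_fin mulr_ge0 ?(ltW h0)// le_min ler01 mulr_ge0 ?expR_ge0//
      (le_trans ler01).
  apply: lee_sum => k _; rewrite EFinM muleCA lee_wpmul2l ?lee_fin ?(ltW h0)//.
  by apply: (ctmc_tail_le f0 c0 m0 fm drift); rewrite mulr_ge0// ltW.
(* The error is [P B * (h * 2)], at most [e] by the choice of [h] and [P B <= 1]. *)
rewrite EFinD muleDr// muleC leeD2l//.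
rewrite -[leRHS]mul1e he lee_wpmul2r ?lee_fin ?(ltW e0)//.
exact: probability_le1.
Qed.

End ctmc.

Theorem lemma4p4 (R : realType)
    (d : measure_display) (Omega : measurableType d) (P : probability Omega R)
    (Ybar : choiceType) (Y : {fset Ybar})
    (q : Y -> Y -> R) (X : R -> Omega -> Y) (X_ctmc : is_ctmc P X q)
    (Phi : Ybar -> R) (Phi_ge0 : forall y, 0 <= Phi y)
    (Y0 : {fset Ybar}) (Y0_sub : (Y0 `<=` Y)%fset)
    (Phi_Y0 : forall y, y \in Y0 -> Phi y = 0)
    (Phi_min : R)
    (Phi_minE : is_minimum [set Phi y | y in [set` (Y `\` Y0)%fset]] Phi_min)
    (Phi_min_gt0 : 0 < Phi_min)
    (c : R) (c_gt0 : 0 < c)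
    (drift : forall y : Y,
      generator q (fun z : Y => Phi (val z)) y <= - c * Phi (val y)) :
  forall y : Y, val y \notin Y0 ->
    (0 < P [set w | X 0%R w = y])%E ->
    (cond_expectation P (hitting_time X [set z : Y | val z \in Y0])
       [set w | X 0%R w = y]
     <= ((1 + ln (Phi (val y) / Phi_min)) / c)%:E)%E.
Proof.
move=> y yY0.
apply: (expected_hitting_time_le X_ctmc (fun z => Phi_ge0 (val z))) => //.
  (* The lower bound half of [is_minimum] supplies [Phi_min] as the constant [m]. *)
  move=> z /negP zY0; case: Phi_minE => _; apply; exists (val z) => //=.
  by rewrite in_fsetD zY0 fsvalP.
by move=> /= yin; rewrite yin in yY0.
Qed.
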